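(* Let $n\ge 4$ and $3\le d\le n$, and let $K\subset\mathbb{R}^n$ be a bounded set containing a translated and dilated copy of every $(d-2)$-sphere meridian passing through the fixed poles $N,S$ of the sphere $S^{d-1}\subset\mathbb{R}^n$. That is, for every meridian $C$ of $S^{d-1}$ there are a point $a\in\mathbb{R}^n$ and a number $r>0$ (both possibly depending on $C$) with $a+rC\subset K$. Then the Hausdorff dimension of $K$ satisfies $$\dim_H(K)\ge d-1.$$
   Context: The sphere is $$S^{d-1}=\Big\{(x_1,\ldots,x_d,0,\ldots,0)\in\mathbb{R}^n:\ \sum_{j=1}^d x_j^2=1\Big\},$$ and its fixed poles are $N=(0,\ldots,0,1,0,\ldots,0)$ and $S=-N$, where the nonzero entry is in the $d$-th coordinate. A meridian is the $(d-2)$-dimensional sphere obtained as the intersection of $S^{d-1}$ with a $(d-1)$-dimensional plane $H$ contained in $\mathbb{R}^d\times\{0\}=\{(x_1,\ldots,x_d,0,\ldots,0)\}$ and passing through both poles $N$ and $S$ (hence through the origin). $\dim_H$ denotes Hausdorff dimension. *)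

(* Defs.v *)
From HB Require Import structures.
From mathcomp Require Import all_boot all_order all_algebra.
From mathcomp Require Import all_classical all_reals all_analysis.

Set Implicit Arguments.
Unset Strict Implicit.
Unset Printing Implicit Defensive.

Import Order.TTheory GRing.Theory Num.Theory.
Import numFieldNormedType.Exports.

Local Open Scope classical_set_scope.
Local Open Scope ring_scope.

(* The library norm on ['rV[R]_n] is the sup norm, hence this one. *)
Definition enorm (R : realType) (n : nat) (x : 'rV[R]_n) : R :=
  Num.sqrt (\sum_(i < n) x 0 i ^+ 2).

(* Extended-real-valued, so that an unbounded set has diameter [+oo]
   (the real-valued [sup] would give 0); it is [-oo] on the empty set. *)
Definition ediam (R : realType) (n : nat) (A : set 'rV[R]_n) : \bar R :=
  ereal_sup [set (enorm (x - y))%:E | x in A & y in A].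

(* [(diam A)^s], with the usual conventions that the empty set contributes 0
   for every [s], and that [0^0 = 1] (so that [s = 0] gives counting measure). *)
Definition diam_pow (R : realType) (n : nat) (s : R) (A : set 'rV[R]_n) :
    \bar R :=
  if A == set0 then 0%E else (ediam A `^ s)%E.

Definition delta_cover (R : realType) (n : nat) (delta : R)
    (A : set 'rV[R]_n) : set (nat -> set 'rV[R]_n) :=
  [set U | A `<=` \bigcup_i U i /\ forall i, (ediam (U i) <= delta%:E)%E].

Definition hausdorff_premeasure (R : realType) (n : nat) (s delta : R)
    (A : set 'rV[R]_n) : \bar R :=
  ereal_inf [set (\sum_(0 <= i <oo) diam_pow s (U i))%E
            | U in delta_cover delta A].

(* Outer measure, defined on arbitrary sets; the supremum over [delta > 0] is
   the limit as [delta] tends to 0, by monotonicity. *)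
Definition hausdorff_measure (R : realType) (n : nat) (s : R)
    (A : set 'rV[R]_n) : \bar R :=
  ereal_sup [set hausdorff_premeasure s delta A | delta in [set e : R | 0 < e]].

Definition hausdorff_dim (R : realType) (n : nat) (A : set 'rV[R]_n) : \bar R :=
  ereal_inf [set s%:E | s in [set s : R | 0 <= s /\ hausdorff_measure s A = 0%E]].

(* [R^d x {0}]; coordinates are numbered from 0, so [x_1, ..., x_d] are those
   of index [i < d]. *)
Definition coord_subspace (R : realType) (n d : nat) : set 'rV[R]_n :=
  [set x | forall i : 'I_n, (d <= i)%N -> x 0 i = 0].

Definition sphere (R : realType) (n d : nat) : set 'rV[R]_n :=
  [set x | coord_subspace d x /\ \sum_(i < n | (i < d)%N) x 0 i ^+ 2 = 1].

Definition north_pole (R : realType) (n d : nat) : 'rV[R]_n :=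
  \row_(i < n) (i == d.-1 :> nat)%:R.

Definition south_pole (R : realType) (n d : nat) : 'rV[R]_n :=
  - north_pole R n d.

Definition affine_plane (R : realType) (n k : nat) (H : set 'rV[R]_n) : Prop :=
  exists (p : 'rV[R]_n) (V : {vspace 'rV[R]_n}),
    \dim V = k /\ H = [set p + v | v in [set` V]].

Definition meridian (R : realType) (n d : nat) (C : set 'rV[R]_n) : Prop :=
  exists H : set 'rV[R]_n,
    [/\ affine_plane d.-1 H, H `<=` coord_subspace d,
        H (north_pole R n d), H (south_pole R n d)
      & C = sphere d `&` H].

(* Main.v *)
Require Import Defs.
From HB Require Import structures.
From mathcomp Require Import all_boot all_order all_algebra.
From mathcomp Require Import all_classical all_reals all_analysis.
From mathcomp Require Import measurable_realfun.
From mathcomp Require Import ring lra zify.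
Import Order.TTheory GRing.Theory Num.Theory.
Import numFieldNormedType.Exports.

Local Open Scope classical_set_scope.
Local Open Scope ring_scope.

(* Forgetting the pole coordinate turns the meridian in the hyperplane
   [x_1 = t x_0] into a full disc of that hyperplane in [R^(d-1)], so the
   meridians with [0 <= t <= 1] reduce the claim to a Kakeya problem.  For [t] in
   a set of positive outer Lebesgue measure all the translated discs contain a
   graph [x_1 = t x_0 + b t] over one common box.  Slicing a cover of the
   projection along the coordinates other than [x_0], [x_1] (Fubini) leaves
   Kakeya's problem in the plane, where Cordoba's [L^2] argument applies.  Let
   [y > 1].  For some [k], a fraction of order at least [y^-k] of the segments
   have a fraction of order at least [y^-k] of their length covered by squares
   of side [2^-k].  As segments of slopes [t], [t'] share [O(1 / |t - t'|)] such
   squares, Cauchy-Schwarz yields, up to a constant, at least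
   [4^k y^(-4k) / (k + 2)] of them. *)

(** * Dyadic cells and pigeonholing in outer Lebesgue measure *)

Notation outer_lebesgue R := (mu_ext (@lebesgue_measure R)).

Lemma lebesgue_cell_union (R : realType) (a : R) (k : nat) (P : pred nat) :
  let C := \bigcup_(z in [set z | (z <= 2 ^ k)%N && P z])
     `[a + z%:R / 2 ^+ k, a + z.+1%:R / 2 ^+ k]%classic in
  measurable (C : set R) /\
  (lebesgue_measure (C : set R) <=
    (#|[pred z : 'I_(2 ^ k).+1 | P z]|%:R / 2 ^+ k)%:E)%E.
Proof.
move=> C; pose F z : set R :=
  if P z then `[a + z%:R / 2 ^+ k, a + z.+1%:R / 2 ^+ k]%classic else set0.
have CE : C = \big[setU/set0]_(z < (2 ^ k).+1) F z.
  rewrite -bigcup_mkord /C; apply/seteqP; split => x.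
  - by move=> [z /= /andP[zk Pz] xz]; exists z => //=; rewrite /F Pz.
  - move=> [z /= zk]; rewrite /F; case: ifPn => // Pz xz.
    by exists z => //=; rewrite -ltnS zk.
have mF z : measurable (F z) by rewrite /F; case: ifP.
split; first by rewrite CE; apply: bigsetU_measurable.
rewrite CE; apply: (le_trans (Boole_inequality _ _)) => [i _|]; first exact: mF.
rewrite (eq_bigr (fun z : 'I_(2 ^ k).+1 =>
   (if P z then (2 ^+ k)^-1 else 0 : R)%:E)); last first.
  move=> z _; rewrite /F; case: ifPn => Pz; last exact: measure0.
  apply: eq_trans (lebesgue_measure_itv _) _ => /=; rewrite lte_fin ltrD2l ltr_pM2r ?invr_gt0 ?exprn_gt0//.
  rewrite ltr_nat ltnSn -EFinD; congr EFin.
  by rewrite -natr1; ring.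
rewrite sumEFin lee_fin -big_mkcond /= sumr_const -[leLHS]mulr_natl.
by [].
Qed.

Lemma nneseries_geometric (R : realType) (a q : R) : 0 <= q < 1 ->
  (\sum_(0 <= k <oo) (a * q ^+ k)%:E)%E = (a / (1 - q))%:E.
Proof.
move=> /andP[q0 q1].
have q1' : `|q| < 1 by rewrite ger0_norm.
have -> : (fun n => \sum_(0 <= k < n) (a * q ^+ k)%:E)%E =
    EFin \o series (geometric a q).
  by apply/funext => n /=; rewrite sumEFin.
rewrite EFin_lim; last exact: is_cvg_geometric_series.
by congr EFin; apply: cvg_lim => //; exact: cvg_geometric_series.
Qed.

(* [H k z] selects the cell [a + z 2^-k, a + (z + 1) 2^-k]. *)
Lemma dyadic_pigeonhole (R : realType) (X : set R) (a e q : R) (H : nat -> pred nat) :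
  0 < e -> 0 < q < 1 -> (e%:E <= outer_lebesgue R X)%E ->
  (forall x, X x -> exists k z, [/\ (z <= 2 ^ k)%N, H k z &
     z%:R <= 2 ^+ k * (x - a) <= z.+1%:R]) ->
  exists k, e * (1 - q) / 2 * q ^+ k * 2 ^+ k
     <= #|[pred z : 'I_(2 ^ k).+1 | H k z]|%:R.
Proof.
move=> e0 /andP[q0 q1] eX cov; apply: contrapT => /forallNP /= small.
pose C k := \bigcup_(z in [set z | (z <= 2 ^ k)%N && H k z])
     `[a + z%:R / 2 ^+ k, a + z.+1%:R / 2 ^+ k]%classic.
have XC : X `<=` \bigcup_k C k.
  move=> x /cov[k [z [zk Hz /andP[x1 x2]]]]; exists k => //; exists z => /=.
    by rewrite zk.
  have p2 : (0 : R) < 2 ^+ k by rewrite exprn_gt0.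
  rewrite in_itv /=; apply/andP; split.
  - by rewrite -lerBrDl ler_pdivrMr// mulrC.
  - by rewrite -lerBlDl ler_pdivlMr// mulrC.
(* Under [small], the cells selected at scale [k] have total length at most
   [e * (1 - q) / 2 * q ^+ k], and these lengths sum to [e / 2]. *)
suff : (outer_lebesgue R X <= (e / 2)%:E)%E.
  by move=> /(le_trans eX); rewrite lee_fin; lra.
apply: (le_trans (le_mu_ext _ _)); first exact: XC.
apply: (le_trans (mu_ext_sigma_subadditive _ _)) => //.
have -> : e / 2 = (e * (1 - q) / 2) / (1 - q).
  by field; lra.
rewrite -nneseries_geometric; last by rewrite (ltW q0).
apply: lee_nneseries => [k _ _|k _].
  by apply: mu_ext_ge0 => Y; exact: measure_ge0.
have [mC muC] := lebesgue_cell_union R a k (H k).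
rewrite measurable_mu_extE//; apply: (le_trans muC); rewrite lee_fin.
rewrite ler_pdivrMr ?exprn_gt0//.
by have /negP := small k; rewrite -ltNge => /ltW.
Qed.

(** * Counting collisions between tubes *)

(** Cauchy-Schwarz: the fibre sizes [N y] of [f] on [D] sum to [#|D|], and their squares sum to the
    number of colliding pairs. *)
Lemma card_sq_le_collisions (R : realFieldType) (I : finType) (J : eqType)
    (D : pred I) (f : I -> J) :
  #|D|%:R ^+ 2 <= (size (undup [seq f u | u in D]))%:R *
    (\sum_(u in D) \sum_(v in D) (f u == f v)%:R) :> R.
Proof.
set s := undup _; set Q := \sum_(u in D) _.
pose N y : R := \sum_(u in D) (f u == y)%:R.
have us : uniq s by exact: undup_uniq.
have fs u : u \in D -> f u \in s.
  by move=> uD; rewrite mem_undup map_f// mem_enum.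
have one u (F : J -> R) : u \in D -> \sum_(y <- s) (f u == y)%:R * F y = F (f u).
  move=> uD; rewrite (bigD1_seq (f u)) ?fs//= eqxx mul1r big1 ?addr0// => y.
  by rewrite eq_sym => /negbTE ->; rewrite mul0r.
have sumN : \sum_(y <- s) N y = #|D|%:R.
  rewrite /N exchange_big /= -sum1_card natr_sum; apply: eq_bigr => u uD.
  by rewrite -[RHS](one u (fun=> 1) uD); apply: eq_bigr => y _; rewrite mulr1.
have sumN2 : \sum_(y <- s) N y ^+ 2 = Q.
  under eq_bigr => y _.
    rewrite expr2 {1}/N big_distrl /=; over.
  rewrite exchange_big /=; apply: eq_bigr => u uD; rewrite one//.
  by rewrite /N; apply: eq_bigr => v _; rewrite eq_sym.
case: (posnP (size s)) => [s0|s0].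
  have := sumN; rewrite (size0nil s0) big_nil => <-.
  by rewrite expr0n /= mul0r.
have M0 : 0 < (size s)%:R :> R by rewrite ltr0n.
have : 0 <= \sum_(y <- s) ((size s)%:R * N y - #|D|%:R) ^+ 2.
  by apply: sumr_ge0 => y _; exact: sqr_ge0.
rewrite (eq_bigr (fun y => (size s)%:R ^+ 2 * N y ^+ 2
     - (2 * (size s)%:R * #|D|%:R) * N y + #|D|%:R ^+ 2)) => [|y _]; last by ring.
rewrite big_split sumrB /= -2!big_distrr /= sumN sumN2.
rewrite big_const_seq count_predT iter_addr_0 -(mulr_natr (_ ^+ 2)) => h.
have {}h : 0 <= (size s)%:R * ((size s)%:R * Q - #|D|%:R ^+ 2) by lra.
by rewrite -subr_ge0 -(pmulr_rge0 _ M0).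
Qed.

Lemma card_window {R : realFieldType} n (P : pred 'I_n) (L : R) : 0 <= L + 1 ->
  (forall z1 z2 : 'I_n, P z1 -> P z2 -> z1%:R - z2%:R <= L) -> #|P|%:R <= L + 1.
Proof.
move=> L0 win; case: (pickP P) => [z0 Pz0|P0]; last by rewrite eq_card0.
case: (arg_minnP (fun z : 'I_n => z : nat) Pz0) => m Pm mmin.
case: (arg_maxnP (fun z : 'I_n => z : nat) Pz0) => M PM Mmax.
apply: (@le_trans _ _ (M%:R - m%:R + 1)); last by rewrite lerD2r win.
rewrite -natrB ?mmin// natr1 ler_nat.
rewrite cardE -(size_map (@nat_of_ord n)) -(size_iota m (M - m).+1).
apply: uniq_leq_size; first by rewrite map_inj_uniq ?enum_uniq//; exact: val_inj.
move=> z /mapP[y]; rewrite mem_enum => Py ->; rewrite mem_iota.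
by have := mmin _ Py; have := Mmax _ Py; lia.
Qed.

(** A window of length [L] holds at most [L + 1] integers: this bounds the number of nonempty rows,
    and, with [B] for [L], the size of each row. *)
Lemma sum_rel_window {R : realFieldType} n (P : rel 'I_n) (B L : R) :
    0 <= B + 1 -> 0 <= L + 1 ->
    (forall z z1 z2 : 'I_n, P z z1 -> P z z2 -> z1%:R - z2%:R <= B) ->
    (forall z1 y1 z2 y2 : 'I_n, P z1 y1 -> P z2 y2 -> z1%:R - z2%:R <= L) ->
  \sum_z \sum_y (P z y)%:R <= (B + 1) * (L + 1).
Proof.
move=> B0 L0 winB winL.
have row z : \sum_y (P z y)%:R <= [exists y, P z y]%:R * (B + 1).
  have -> : \sum_y (P z y)%:R = #|P z|%:R :> R.
    by rewrite -natr_sum -big_mkcond sum1_card.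
  case: (boolP [exists y, P z y]) => [_|/existsPn nP].
    by rewrite mul1r; apply: card_window => // y1 y2; exact: winB.
  by rewrite mul0r eq_card0// => y; apply/negbTE/nP.
apply: (le_trans (ler_sum _ (fun z _ => row z))).
rewrite -big_distrl /= mulrC ler_wpM2l// -natr_sum -big_mkcond sum1_card.
apply: card_window => // z1 z2 /existsP[y1 P1] /existsP[y2 P2].
exact: winL P1 P2.
Qed.

(** Passing from [k] to [k + 1] adds [2^k] terms, each at most [2^-k]. *)
Lemma harmonic_dyadic {R : realFieldType} k :
  \sum_(0 <= h < 2 ^ k) (h.+1%:R)^-1 <= k.+1%:R :> R.
Proof.
elim: k => [|k IH]; first by rewrite big_nat1 invr1.
rewrite expnS mul2n -addnn (@big_cat_nat _ _ _ (2 ^ k)) //=; last by lia.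
rewrite -[k.+2]addn1 natrD lerD// -{1}[(2 ^ k)%N]add0n big_addn addnK.
have p0 : (0 : R) < (2 ^ k)%:R by rewrite ltr0n expn_gt0.
apply: (@le_trans _ _ (\sum_(0 <= h < 2 ^ k) ((2 ^ k)%:R)^-1)).
  apply: ler_sum => h _; rewrite lef_pV2 ?posrE ?ltr0n ?expn_gt0// ler_nat; lia.
by rewrite sumr_const_nat subn0 -(mulr_natr (_^-1)) mulVf// gt_eqF.
Qed.

(** Subtraction is truncated, so [(j - i) + (i - j)] is the distance of [i] and [j]; each side of
    [j] contributes at most one harmonic sum. *)
Lemma sum_inv_dist {R : realFieldType} n j : (j < n)%N ->
  \sum_(0 <= i < n) (((j - i) + (i - j)).+1%:R)^-1 <=
  2 * \sum_(0 <= h < n) (h.+1%:R)^-1 :> R.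
Proof.
move=> jn.
have mono m : (m <= n)%N ->
    \sum_(0 <= h < m) (h.+1%:R)^-1 <= \sum_(0 <= h < n) (h.+1%:R)^-1 :> R.
  move=> mn; rewrite [leRHS](@big_cat_nat _ _ _ m)//= lerDl.
  by apply: sumr_ge0.
rewrite (@big_cat_nat _ _ _ j) //=; last exact: ltnW.
rewrite mulr_natl mulr2n lerD//.
- rewrite big_nat_rev /= add0n; apply: le_trans (mono j (ltnW jn)).
  rewrite big_nat [leRHS]big_nat; apply: ler_sum => i /andP[_ ij].
  rewrite lef_pV2 ?posrE ?ltr0n// ler_nat; lia.
- rewrite -{1}[j]add0n big_addn; apply: le_trans (mono (n - j)%N _); last by lia.
  apply: ler_sum => i _; rewrite lef_pV2 ?posrE ?ltr0n// ler_nat; lia.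
Qed.

(* The [L^2] estimate: two tubes whose slopes differ by [h 2^-k] share at most
   [O(2^k / (h + 1))] columns. *)
Lemma tube_collisions {R : realFieldType} (k : nat) (a : R)
    (D : pred ('I_(2 ^ k).+1 * 'I_(2 ^ k).+1))
    (f : 'I_(2 ^ k).+1 * 'I_(2 ^ k).+1 -> nat)
    (t b : 'I_(2 ^ k).+1 -> R) (x : 'I_(2 ^ k).+1 * 'I_(2 ^ k).+1 -> R)
    (X Y : nat -> R) :
  (forall u, D u -> [/\ 0 <= t u.1 <= 1,
     (u.1)%:R <= 2 ^+ k * t u.1 <= (u.1).+1%:R,
     (u.2)%:R <= 2 ^+ k * (x u - a) <= (u.2).+1%:R,
     `|x u - X (f u)| <= 2^-1 ^+ k &
     `|t u.1 * x u + b u.1 - Y (f u)| <= 2^-1 ^+ k]) ->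
  \sum_(u in D) \sum_(v in D) (f u == f v)%:R <= 1008 * 4 ^+ k * k.+2%:R :> R.
Proof.
set N : R := 2 ^+ k => HD.
have N0 : 0 < N by rewrite exprn_gt0.
have N1 : 1 <= N by rewrite exprn_ege1// ler1n.
have NE : (2 ^ k)%:R = N by rewrite natrX.
have VN : 2^-1 ^+ k = N^-1 by rewrite exprVn.
have N4 : 4 ^+ k = N * N by rewrite -exprMn; congr (_ ^+ k); ring.
clearbody N.
pose h (j j' : 'I_(2 ^ k).+1) : R := ((j - j') + (j' - j)).+1%:R.
pose C (j j' : 'I_(2 ^ k).+1) : rel 'I_(2 ^ k).+1 :=
  fun z z' => [&& D (j, z), D (j', z') & f (j, z) == f (j', z')].
(* Points of two tubes assigned to the same square are within two radii horizontally; as slopes are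
   at most 1, the two lines there differ in height by at most four radii. *)
have close j j' z z' : C j j' z z' ->
  `|x (j, z) - x (j', z')| <= 2 * N^-1 /\
  `|(t j - t j') * x (j, z) + (b j - b j')| <= 4 * N^-1.
  move=> /and3P[/HD[/= tj _ _ x1 y1] /HD[/= tj' _ _ x2 y2] /eqP e].
  move: x1 y1 x2 y2; rewrite e VN.
  set X1 := x (j, z); set X2 := x (j', z'); move: (X _) (Y _) => x0 y0.
  move=> x1 y1 x2 y2.
  have d : `|X1 - X2| <= 2 * N^-1.
    rewrite (_ : X1 - X2 = (X1 - x0) - (X2 - x0)); last by ring.
    by apply: (le_trans (ler_normB _ _)); lra.
  split => //.
  rewrite (_ : (t j - t j') * X1 + (b j - b j') = (t j * X1 + b j - y0) -
     (t j' * X2 + b j' - y0) - t j' * (X1 - X2)); last by ring.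
  apply: (le_trans (ler_normB _ _)).
  have : `|t j' * (X1 - X2)| <= 2 * N^-1.
    rewrite normrM -[leRHS]mul1r ler_pM// ger0_norm; lra.
  have := ler_normB (t j * X1 + b j - y0) (t j' * X2 + b j' - y0).
  lra.
have pair j j' : \sum_z \sum_y (C j j' z y)%:R <= 252 * N / h j j'.
  have h0 : 0 < h j j' by rewrite ltr0n.
  have hN : h j j' <= 2 * N.
    rewrite /h -NE -natrM ler_nat; have := ltn_ord j; have := ltn_ord j'.
    by have := expn_gt0 2 k; lia.
  have Nh : 1 / 2 <= N / h j j' by rewrite ler_pdivlMr//; lra.
  set r := N / h j j' in Nh.
  (* [252 = 7 * 36]: a column [z] is paired with at most 7 columns [z'], and the columns [z] that
     occur span at most [36 * r - 1]. *)
  rewrite -mulrA -/r (_ : 252 * r = (6 + 1) * ((36 * r - 1) + 1)); last by ring.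
  apply: sum_rel_window; [lra|lra| |].
  - move=> z z1 z2 c1 c2; have [d1 _] := close _ _ _ _ c1.
    have [d2 _] := close _ _ _ _ c2.
    move: c1 c2 => /and3P[_ /HD[/= _ _ e1 _ _] _] /and3P[_ /HD[/= _ _ e2 _ _] _].
    move: d1 d2 e1 e2; rewrite !ler_distl -!natr1.
    set X0 := x (j, z); set X1 := x _; set X2 := x _.
    have := mulfV (lt0r_neq0 N0); move: N^-1 => V NV.
    move=> /andP[? ?] /andP[? ?] /andP[? ?] /andP[? ?].
    have : N * (X1 - X2) <= 4 * (N * V) by rewrite mulrCA ler_pM2l//; lra.
    rewrite NV; lra.
  - move=> z1 y1 z2 y2 c1 c2.
    (* Slopes in equal or adjacent cells need not be separated; there [N <= 2 * r], so the trivial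
       bound [N] on the span is enough. *)
    have [hle|hgt] := leP (h j j') 2.
      have NN : N / 2 <= r by rewrite ler_pM2l// lef_pV2 ?posrE//; lra.
      have : z1%:R <= N by rewrite -NE ler_nat -ltnS.
      have : 0 <= z2%:R :> R by [].
      lra.
    have [_ d1] := close _ _ _ _ c1; have [_ d2] := close _ _ _ _ c2.
    move: c1 c2 => /and3P[/HD[/= _ T e1 _ _] /HD[/= _ T' _ _ _] _].
    move=> /and3P[/HD[/= _ _ e2 _ _] _ _].
    move: d1 d2 e1 e2 T T'; rewrite -!natr1.
    set X1 := x _; set X2 := x _ => d1 d2 e1 e2 T T'.
    (* Each slope lies in its own cell of width [1 / N], so the right side is at least the distance
       of the cell indices minus 1, that is [h - 2], and here [h >= 3]. *)
    have sep : h j j' / 3 <= N * `|t j - t j'|.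
      have hE : h j j' = `|j%:R - j'%:R| + 1.
        rewrite /h -natr1; congr (_ + 1).
        case: (leqP j j') => jj.
          by rewrite (eqP jj) add0n natrB// distrC ger0_norm// subr_ge0 ler_nat.
        by rewrite (eqP (ltnW jj)) addn0 natrB ?(ltnW jj)// ger0_norm// subr_ge0 ler_nat ltnW.
      have : `|j%:R - j'%:R| <= N * `|t j - t j'| + 1.
        rewrite -{1}(ger0_norm (ltW N0)) -normrM.
        have -> : j%:R - j'%:R = N * (t j - t j') + ((j%:R - N * t j) - (j'%:R - N * t j')) by ring.
        by apply: (le_trans (ler_normD _ _)); rewrite lerD2l ler_norml; lra.
      have : 3 <= h j j' by move: hgt; rewrite /h ltr_nat ler_nat.
      lra.
    (* The difference of the two lines is affine of slope [t j - t j'] and at most [4 / N] in size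
       at both [X1] and [X2]. *)
    have {d1 d2} d : `|t j - t j'| * `|X1 - X2| <= 8 * N^-1.
      rewrite -normrM (_ : _ * _ = ((t j - t j') * X1 + (b j - b j')) -
          ((t j - t j') * X2 + (b j - b j'))); last by ring.
      by apply: (le_trans (ler_normB _ _)); lra.
    have dX : `|X1 - X2| <= 24 / h j j'.
      rewrite ler_pdivlMr//.
      have : `|X1 - X2| * (h j j' / 3) <= `|X1 - X2| * (N * `|t j - t j'|) by rewrite ler_wpM2l.
      have : N * (`|t j - t j'| * `|X1 - X2|) <= N * (8 * N^-1) by rewrite ler_pM2l.
      rewrite [N * (8 * _)]mulrCA divff ?gt_eqF//; lra.
    have : N * (X1 - X2) <= 24 * r.
      by rewrite /r mulrCA ler_pM2l//; apply: le_trans (ler_norm _) dX.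
    lra.
have -> : \sum_(u in D) \sum_(v in D) (f u == f v)%:R =
   \sum_j \sum_j' \sum_z \sum_y (C j j' z y)%:R :> R.
  rewrite big_mkcond /= (eq_bigr (fun u => \sum_v
      (C u.1 v.1 u.2 v.2)%:R)); last first.
    move=> [j z] _ /=; rewrite -[in LHS]topredE /= /C /=.
    case: (D (j, z)) => /=; last by rewrite big1.
    rewrite big_mkcond; apply: eq_bigr => -[j' y] _.
    by rewrite -[in LHS]topredE /=; case: (D _).
  rewrite -(pair_bigA _ (fun j z => \sum_v (C j v.1 z v.2)%:R)) /=.
  apply: eq_bigr => j _; rewrite exchange_big /=.
  rewrite -(pair_bigA _ (fun j' y => \sum_z (C j j' z y)%:R)) /=.
  by apply: eq_bigr => j' _; rewrite exchange_big.
(* There are [2^k + 1] indices: the extra harmonic term costs at most 1, whence [k.+2], and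
   [N + 1 <= 2 * N] gives [1008 = 252 * 2 * 2]. *)
apply: (@le_trans _ _ (\sum_(j < (2 ^ k).+1) 252 * N * (2 * k.+2%:R))).
  apply: ler_sum => j _; apply: (le_trans (ler_sum _ (fun j' _ => pair j j'))).
  rewrite -big_distrr /=; apply: ler_wpM2l; first by lra.
  rewrite /h -(big_mkord xpredT (fun i => (((j - i) + (i - j)).+1%:R)^-1 : R)).
  apply: (le_trans (sum_inv_dist _ _ (ltn_ord j))).
  rewrite ler_pM2l//; rewrite big_nat_recr //= -(natr1 k.+1) lerD ?harmonic_dyadic//.
  by rewrite invf_le1 ?ltr0n// ler1n.
rewrite sumr_const card_ord -[leLHS]mulr_natl -natr1 NE.
rewrite N4.
have : 0 <= k.+2%:R :> R by [].
move: (k.+2%:R) => m m0.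
have : N * m * (N + 1) <= N * m * (2 * N) by rewrite ler_wpM2l ?mulr_ge0//; lra.
lra.
Qed.

(** * Kakeya's problem in the plane *)

Lemma sum_seq_le_nneseries {R : realType} (s : seq nat) (P : pred nat) (F : nat -> R) :
  uniq s -> {in s, forall i, P i} -> (forall i, 0 <= F i) ->
  ((\sum_(i <- s) F i)%:E <= \sum_(0 <= i <oo | P i) (F i)%:E)%E.
Proof.
move=> us sP F0; pose N := (\max_(i <- s) i).+1.
have sN : {in s, forall i, (i < N)%N}.
  by move=> i si; rewrite ltnS (big_rem i si)//= leq_maxl.
apply: le_trans (nneseries_lim_ge N _) => [|i _ _]; last by rewrite lee_fin.
rewrite sumEFin lee_fin.
have -> : \sum_(i <- s) F i = \sum_(0 <= i < N | i \in s) F i.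
  rewrite -[RHS]big_filter; apply: perm_big; apply: uniq_perm => //.
    by rewrite filter_uniq// iota_uniq.
  move=> i; rewrite mem_filter mem_index_iota /=.
  by case: (boolP (i \in s)) => //= /sN ->.
rewrite [leRHS](bigID (mem s)) /= -[leLHS]addr0 lerD ?sumr_ge0//.
rewrite le_eqVlt; apply/orP; left; apply/eqP; apply: eq_bigl => i.
by case: (boolP (i \in s)) => [/sP ->|]; rewrite ?andbF.
Qed.

(** Lets one factor [y ^+ k] absorb the factor [k + 2] lost in the [L^2] estimate. *)
Lemma linear_le_expr {R : realFieldType} (y : R) : 1 < y ->
  exists2 m, 0 < m & forall k, m * k.+2%:R <= y ^+ k.
Proof.
move=> y1; exists (Num.min (1 / 2) (y - 1)); first by rewrite lt_min; apply/andP; split; lra.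
set m := Num.min _ _; have m1 : m <= 1 / 2 by rewrite ge_min lexx.
have m2 : m <= y - 1 by rewrite ge_min lexx orbT.
elim=> [|k IH]; first by rewrite expr0; lra.
rewrite -natr1 mulrDr mulr1 exprS.
have : 1 <= y ^+ k by rewrite exprn_ege1// ltW.
move=> h; have : (y - 1) * 1 <= (y - 1) * y ^+ k by rewrite ler_pM2l//; lra.
lra.
Qed.

Lemma outer_lebesgue_itv {R : realType} (a b : R) : a <= b ->
  outer_lebesgue R `[a, b]%classic = (b - a)%:E.
Proof.
move=> ab; rewrite measurable_mu_extE; last exact: measurable_itv.
apply: eq_trans (lebesgue_measure_itv _) _ => /=; rewrite lte_fin.
by case: ltgtP ab => // -> _; rewrite subrr.
Qed.

(* Square number [i] has centre [(X i, Y i)] and radius [2^-(r i)]; with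
   [y ^+ 5 = 2 `^ sigma] its weight is its radius to the power [2 - sigma]. *)
Lemma kakeya_plane {R : realType} (T : set R) (b : R -> R) (e a1 a2 y : R) :
  T `<=` `[0, 1]%classic -> 0 < e -> (e%:E <= outer_lebesgue R T)%E ->
  a1 < a2 <= a1 + 1 -> 1 < y ->
  exists2 c, 0 < c & forall (A : pred nat) (X Y : nat -> R) (r : nat -> nat),
    (forall t x, T t -> a1 <= x <= a2 -> exists i,
      [/\ A i, `|x - X i| <= 2^-1 ^+ r i & `|t * x + b t - Y i| <= 2^-1 ^+ r i]) ->
    (c%:E <= \sum_(0 <= i <oo | A i) ((y ^+ 5 / 4) ^+ r i)%:E)%E.
Proof.
move=> T01 e0 eT /andP[a12 a21] y1.
have y0 : 0 < y by lra.
pose q := y^-1.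
have q01 : 0 < q < 1 by rewrite invr_gt0 y0 invf_lt1.
pose c1 := (a2 - a1) * (1 - q) / 2; pose c2 := e * (1 - q) / 2.
have c10 : 0 < c1 by rewrite divr_gt0// mulr_gt0//; lra.
have c20 : 0 < c2 by rewrite divr_gt0// mulr_gt0//; lra.
have [m m0 my] := linear_le_expr y y1.
exists ((c1 * c2) ^+ 2 / 1008 * m) => [|A X Y r cov].
  apply: mulr_gt0; last exact: m0.
  by apply: divr_gt0; [exact/exprn_gt0/mulr_gt0|rewrite ltr0n].
(* Only squares of radius exactly [2^-k] count at scale [k], so that one scale can be selected. *)
pose Hit t k (z : nat) := `[< exists x i, [/\ A i, r i = k,
   z%:R <= 2 ^+ k * (x - a1) <= z.+1%:R,
   `|x - X i| <= 2^-1 ^+ k & `|t * x + b t - Y i| <= 2^-1 ^+ k] >].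
have cell (k : nat) (v : R) : 0 <= v <= 1 -> exists z,
    (z <= 2 ^ k)%N /\ z%:R <= 2 ^+ k * v <= z.+1%:R.
  move=> /andP[v0 v1]; have w0 : 0 <= 2 ^+ k * v by rewrite mulr_ge0// exprn_ge0.
  exists (Num.truncn (2 ^+ k * v)).
  have /andP[t1 t2] := truncn_itv w0; split; last by rewrite t1 ltW.
  rewrite -(ler_nat R) natrX (le_trans t1)// -[leRHS]mulr1 ler_wpM2l//.
(* First pigeonhole, along each segment; the scale still depends on [t]. *)
have hitT t : T t -> exists k, c1 * q ^+ k * 2 ^+ k
     <= #|[pred z : 'I_(2 ^ k).+1 | Hit t k z]|%:R.
  move=> Tt; apply: (dyadic_pigeonhole R `[a1, a2]%classic a1 (a2 - a1) q (Hit t)) => //.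
  - lra.
  - by rewrite outer_lebesgue_itv// ltW.
  - move=> x /=; rewrite in_itv /= => /andP[x1 x2].
    have [|i [Ai Xi Yi]] := cov t x Tt; first by rewrite x1.
    have [|z [zk zx]] := cell (r i) (x - a1); first by apply/andP; split; lra.
    by exists (r i), z; split=> //; apply/asboolP; exists x, i.
pose G k (j : nat) := `[< exists t, [/\ T t, j%:R <= 2 ^+ k * t <= j.+1%:R &
   c1 * q ^+ k * 2 ^+ k <= #|[pred z : 'I_(2 ^ k).+1 | Hit t k z]|%:R] >].
(* Second pigeonhole, over the slopes: a single scale [k] now serves a proportion of order [q ^+ k]
   of the slope cells. *)
have [k Gk] : exists k, c2 * q ^+ k * 2 ^+ k <= #|[pred z : 'I_(2 ^ k).+1 | G k z]|%:R.
  apply: (dyadic_pigeonhole R T 0 e q G) => // t Tt; have [k kt] := hitT t Tt.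
  have t01 : 0 <= t <= 1 by have := T01 _ Tt; rewrite /= in_itv.
  have [z [zk zt]] := cell k t t01; exists k, z; rewrite subr0; split => //.
  by apply/asboolP; exists t.
have /choice[t tP] (j : 'I_(2 ^ k).+1) : exists t, G k j -> [/\ T t,
    j%:R <= 2 ^+ k * t <= j.+1%:R &
    c1 * q ^+ k * 2 ^+ k <= #|[pred z : 'I_(2 ^ k).+1 | Hit t k z]|%:R].
  by have [/asboolP[t]|] := boolP (G k j); [exists t|exists 0].
(* Pairs of a slope cell and a column hit by its chosen segment; [f] below sends such a pair to a
   square hit there, so its distinct values count squares of radius [2^-k]. *)
pose D (u : 'I_(2 ^ k).+1 * 'I_(2 ^ k).+1) := G k u.1 && Hit (t u.1) k u.2.
have /choice[p pP] u : exists p : R * nat, D u -> [/\ A p.2, r p.2 = k,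
   u.2%:R <= 2 ^+ k * (p.1 - a1) <= u.2.+1%:R,
   `|p.1 - X p.2| <= 2^-1 ^+ k & `|t u.1 * p.1 + b (t u.1) - Y p.2| <= 2^-1 ^+ k].
  have [|] := boolP (D u); last by exists (0, 0%N).
  by move=> /andP[_ /asboolP[x [i h]]]; exists (x, i).
pose f u := (p u).2.
have colD : \sum_(u in D) \sum_(v in D) (f u == f v)%:R <= 1008 * 4 ^+ k * k.+2%:R :> R.
  apply: (tube_collisions k a1 D f t (fun j => b (t j)) (fun u => (p u).1) X Y).
  move=> u Du; have [_ _ ? ? ?] := pP u Du; have /andP[/tP[Tt ? _] _] := Du.
  by split => //; have := T01 _ Tt; rewrite /= in_itv.
have p20 : (0 : R) <= 2 ^+ k by rewrite exprn_ge0.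
have qk0 : 0 <= q ^+ k by rewrite exprn_ge0// invr_ge0 ltW.
have n10 : 0 <= c1 * q ^+ k * 2 ^+ k by exact: mulr_ge0 (mulr_ge0 (ltW c10) qk0) p20.
have n20 : 0 <= c2 * q ^+ k * 2 ^+ k by exact: mulr_ge0 (mulr_ge0 (ltW c20) qk0) p20.
have cardD : c2 * q ^+ k * 2 ^+ k * (c1 * q ^+ k * 2 ^+ k) <= #|D|%:R.
  have -> : #|D|%:R = \sum_(j : 'I_(2 ^ k).+1 | G k j) #|[pred z : 'I_(2 ^ k).+1 | Hit (t j) k z]|%:R :> R.
    rewrite -natr_sum; congr (_%:R).
    under eq_bigr do rewrite -sum1_card.
    by rewrite -sum1_card pair_big_dep; apply: eq_bigl => u.
  apply: (@le_trans _ _ (\sum_(j : 'I_(2 ^ k).+1 | G k j) (c1 * q ^+ k * 2 ^+ k))).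
    rewrite sumr_const -[leRHS]mulr_natl; exact: ler_wpM2r.
  by apply: ler_sum => j /tP[].
set s := undup [seq f u | u in D].
have fs : {in s, forall i, A i /\ r i = k}.
  by move=> i; rewrite mem_undup => /mapP[u]; rewrite mem_enum => /pP[? ? _ _ _] ->.
have le_s : (((size s)%:R * (y ^+ 5 / 4) ^+ k)%:E
    <= \sum_(0 <= i <oo | A i) ((y ^+ 5 / 4) ^+ r i)%:E)%E.
  rewrite (_ : _ * _ = \sum_(i <- s) (y ^+ 5 / 4) ^+ r i); last first.
    rewrite big_seq (eq_bigr (fun=> (y ^+ 5 / 4) ^+ k)); last by move=> i /fs[_ ->].
    by rewrite -big_seq big_const_seq count_predT iter_addr_0 mulr_natl.
  apply: sum_seq_le_nneseries; [exact: undup_uniq|by move=> i /fs[]|move=> i].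
  by rewrite exprn_ge0// divr_ge0// exprn_ge0// ltW.
apply: le_trans le_s; rewrite lee_fin.
have := card_sq_le_collisions R _ _ D f; rewrite -/s => CS.
(* [q ^+ k] enters the lower bound for [#|D|] twice, hence four times after squaring; multiplying by
   [(y ^+ k) ^+ 4] cancels it. *)
have {}CS : (c1 * c2) ^+ 2 * 4 ^+ k <= (size s)%:R * 1008 * k.+2%:R * (y ^+ k) ^+ 4.
  have a0 : (0 : R) < 4 ^+ k by rewrite exprn_gt0.
  have aE : 4 ^+ k = 2 ^+ k * 2 ^+ k :> R by rewrite -exprMn; congr (_ ^+ k); ring.
  have qy : q ^+ k * y ^+ k = 1 by rewrite -exprMn mulVf ?expr1n// gt_eqF.
  have yk0 : 0 < y ^+ k by rewrite exprn_gt0.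
  have L0 : 0 <= c2 * q ^+ k * 2 ^+ k * (c1 * q ^+ k * 2 ^+ k).
    exact: mulr_ge0.
  rewrite -(ler_pM2r a0).
  have h : (c2 * q ^+ k * 2 ^+ k * (c1 * q ^+ k * 2 ^+ k)) ^+ 2 <=
      (size s)%:R * (1008 * 4 ^+ k * k.+2%:R).
    apply: le_trans (_ : #|D|%:R ^+ 2 <= _); first by rewrite lerXn2r// nnegrE.
    by apply: (le_trans CS); rewrite ler_wpM2l.
  have : (c2 * q ^+ k * 2 ^+ k * (c1 * q ^+ k * 2 ^+ k)) ^+ 2 * (y ^+ k) ^+ 4 <=
      (size s)%:R * (1008 * 4 ^+ k * k.+2%:R) * (y ^+ k) ^+ 4.
    by rewrite ler_wpM2r// exprn_ge0// ltW.
  have -> : (c2 * q ^+ k * 2 ^+ k * (c1 * q ^+ k * 2 ^+ k)) ^+ 2 * (y ^+ k) ^+ 4 =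
    (c1 * c2) ^+ 2 * (2 ^+ k * 2 ^+ k) * (2 ^+ k * 2 ^+ k) * (q ^+ k * y ^+ k) ^+ 4 by ring.
  by rewrite qy -aE expr1n mulr1; lra.
have mk := my k.
rewrite expr_div_n -exprM mulnC exprM.
set z := y ^+ k in CS mk *; set a := 4 ^+ k in CS *.
have a0 : 0 < a by rewrite exprn_gt0.
have z0 : 0 < z by rewrite exprn_gt0.
have k0 : (0 : R) < k.+2%:R by rewrite ltr0n.
rewrite [leRHS]mulrA ler_pdivlMr//.
have h1 : (c1 * c2) ^+ 2 * a * m <= (size s)%:R * 1008 * k.+2%:R * z ^+ 4 * m by rewrite ler_pM2r.
(* This accounts for the fifth power of [y] in the weight: four factors come from the pigeonholing,
   the fifth absorbs [k.+2]. *)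
have : (size s)%:R * 1008 * z ^+ 4 * (m * k.+2%:R) <= (size s)%:R * 1008 * z ^+ 4 * z.
  apply: ler_wpM2l; last exact: mk.
  apply: mulr_ge0; first by apply: mulr_ge0; rewrite ler0n.
  exact/exprn_ge0/ltW.
lra.
Qed.

(** * Slicing along coordinate directions *)

(** Integrate the slice inequality over [v] in [[a, b]] and exchange sum and integral: index [i] is
    active on a set of length at most [2 * d i]. *)
Lemma nneseries_slice {R : realType} (a b c : R) (A : pred nat) (g x d : nat -> R) :
  a <= b -> (forall i, 0 <= g i) -> (forall i, 0 <= d i) ->
  (forall v, a <= v <= b ->
    (c%:E <= \sum_(0 <= i <oo | A i && (`|v - x i| <= d i)%R) (g i)%:E)%E) ->
  ((c * (b - a))%:E <= \sum_(0 <= i <oo | A i) (g i * (2 * d i))%:E)%E.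
Proof.
move=> ab g0 d0 slice.
pose S i : set R := `[x i - d i, x i + d i]%classic.
pose g' i : R := if A i then g i else 0.
have g'0 i : 0 <= g' i by rewrite /g'; case: ifP.
pose F i v : \bar R := ((g' i)%:E * (\1_(S i) v)%:E)%E.
have F0 i v : (0 <= F i v)%E by rewrite mule_ge0 ?lee_fin.
have mS i : measurable (S i) by exact: measurable_itv.
have mD : measurable (`[a, b]%classic : set R) by exact: measurable_itv.
have mI i : measurable_fun (`[a, b]%classic : set R) (EFin \o \1_(S i) : R -> \bar R).
  by apply/measurable_EFinP; exact: measurable_indic.
have mF i : measurable_fun (`[a, b]%classic : set R) (F i).
  by apply: measurable_funeM; exact: (mI i).
have -> : ((c * (b - a))%:E = \int[lebesgue_measure]_(v in `[a, b]) c%:E)%E.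
  rewrite integral_cst//= lebesgue_measure_itv /= lte_fin EFinM.
  by case: ltgtP ab => // -> _; rewrite subrr mule0.
apply: (@le_trans _ _ (\int[lebesgue_measure]_(v in `[a, b])
    \sum_(0 <= i <oo) F i v)%E).
  have [c0|c0] := leP 0 c; last first.
    apply: (@le_trans _ _ 0%E); last first.
      by apply: integral_ge0 => v _; apply: nneseries_ge0.
    rewrite integral_cst//= mule_le0_ge0//.
    by rewrite lee_fin ltW.
  apply: ge0_le_integral => //.
  - apply: (@ge0_emeasurable_sum _ _ R _ F xpredT) => [i v _ _|i _].
      exact: F0.
    exact: mF.
  - move=> v /=; rewrite in_itv /= => /slice; rewrite eseries_mkcond.
    move=> /le_trans; apply; apply: lee_nneseries => i _ /=.
      by move=> _; case: ifP; rewrite lee_fin.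
    rewrite /F /g' indicE; case: (A i) => /=; last by rewrite mul0e.
    case: ifPn => [h|_]; last by rewrite mule_ge0 ?lee_fin.
    rewrite mem_set ?mule1// /S /= in_itv /=; move: h; rewrite ler_distl.
    by move=> /andP[? ?]; apply/andP; split; lra.
rewrite integral_nneseries//.
rewrite [leRHS]eseries_mkcond; apply: lee_nneseries => [i _ _|i _].
  exact: integral_ge0.
rewrite /F ge0_integralZl//; [|exact: mI|by rewrite lee_fin].
rewrite integral_indic//; last exact: mS.
rewrite /g'; case: (A i) => /=; last by rewrite mul0e.
rewrite EFinM lee_wpmul2l ?lee_fin//.
apply: (@le_trans _ _ (lebesgue_measure (S i))).
  by apply: le_measure; rewrite ?inE; [exact: (measurableI _ _ (mS i) mD)|exact: mS|exact: subIsetl].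
rewrite /S lebesgue_measure_itv /= lte_fin; case: ifP => _.
  by rewrite -EFinB lee_fin; lra.
by rewrite lee_fin mulr_ge0.
Qed.

(** Induction on [L], one slicing per coordinate. Both bounds quantify over every index set [A],
    because fixing a coordinate keeps only the indices whose interval contains the fixed value. *)
Lemma cylinder_content {R : realType} (n : nat) (Y : Type) (Q : Y -> Prop)
    (B : Y -> nat -> Prop) (g d : nat -> R) (p : nat -> 'I_n -> R)
    (lo : 'I_n -> R) (l c : R) (L : seq 'I_n) :
  0 <= l -> uniq L -> (forall i, 0 <= g i) -> (forall i, 0 <= d i) ->
  (forall A : pred nat, (forall y, Q y -> exists i, A i /\ B y i) ->
     (c%:E <= \sum_(0 <= i <oo | A i) (g i)%:E)%E) ->
  forall A : pred nat,
  (forall y (w : 'I_n -> R), Q y -> (forall j, j \in L -> lo j <= w j <= lo j + l) ->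
     exists i, [/\ A i, B y i & forall j, j \in L -> `|w j - p i j| <= d i]) ->
  ((c * l ^+ size L)%:E <=
     \sum_(0 <= i <oo | A i) (g i * (2 * d i) ^+ size L)%:E)%E.
Proof.
move=> l0 uL g0 d0 base; elim: L uL => [_|j L IH /= /andP[jL uL]] A cov.
  rewrite expr0 mulr1; under eq_eseriesr do rewrite expr0 mulr1.
  apply: base => y Qy; have [//|i [Ai Bi _]] := cov y (fun=> 0) Qy.
  by exists i.
rewrite exprSr mulrA.
have -> : (\sum_(0 <= i <oo | A i) (g i * (2 * d i) ^+ (size L).+1)%:E =
   \sum_(0 <= i <oo | A i) ((g i * (2 * d i) ^+ size L) * (2 * d i))%:E)%E.
  by apply: eq_eseriesr => i _; rewrite exprSr mulrA.
rewrite (_ : l = (lo j + l) - lo j); last by ring.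
apply: nneseries_slice => //.
- lra.
- by move=> i; rewrite mulr_ge0// exprn_ge0// mulr_ge0.
move=> v vj; rewrite (_ : lo j + l - lo j = l); last by ring.
apply: (IH uL (fun i => A i && (`|v - p i j| <= d i))) => y w Qy wL.
have [k|i [Ai Bi wi]] := cov y (fun k => if k == j then v else w k) Qy.
  by rewrite inE; case: eqVneq => [-> _|_ /= /wL].
exists i; split => //.
  by rewrite Ai; have := wi j (mem_head _ _); rewrite eqxx.
move=> k kL; have := wi k; rewrite inE kL orbT => /(_ isT).
by case: eqVneq kL jL => // -> ->.
Qed.

(** * Countable pigeonhole and dyadic radii *)

(** Countable subadditivity over the fibres of [f]; these may fail to be measurable, hence the outer
    measure. *)
Lemma outer_lebesgue_pigeonhole {R : realType} (f : R -> nat) :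
  exists k e, 0 < e /\
    (e%:E <= outer_lebesgue R [set t : R | (0 <= t <= 1)%R /\ f t = k])%E.
Proof.
pose T k := [set t : R | 0 <= t <= 1 /\ f t = k].
have T01 k : T k `<=` `[0, 1]%classic by move=> t [t01 _]; rewrite /= in_itv.
have o01 : outer_lebesgue R `[0, 1]%classic = 1%E.
  by rewrite outer_lebesgue_itv// subr0.
have oT k : (outer_lebesgue R (T k) <= 1)%E by rewrite -o01; apply: le_mu_ext.
have o0 X : (0 <= outer_lebesgue R X)%E by apply: mu_ext_ge0 => Y; exact: measure_ge0.
apply: contrapT => none.
have T0 k : outer_lebesgue R (T k) = 0%E.
  apply: contrapT => /eqP Tk; apply: none; exists k, (fine (outer_lebesgue R (T k))).
  have fT : outer_lebesgue R (T k) \is a fin_num.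
    by rewrite ge0_fin_numE//; apply: le_lt_trans (oT k) _; rewrite ltry.
  by rewrite fineK// fine_gt0// lt0e Tk o0 -ge0_fin_numE.
have : (outer_lebesgue R `[0%R, 1%R]%classic <= 0)%E.
  pose U : set R := \bigcup_k T k.
  have sub : `[0%R, 1%R]%classic `<=` U.
    by move=> t /=; rewrite in_itv /= => t01; exists (f t).
  apply: (@le_trans _ _ (outer_lebesgue R U)); first exact: le_mu_ext.
  apply: (le_trans (mu_ext_sigma_subadditive _ _)) => //.
  by rewrite eseries0.
by rewrite o01 lee_fin ler10.
Qed.

Lemma expr_lt_small {R : realType} (q e : R) : 0 <= q < 1 -> 0 < e ->
  exists k, q ^+ k < e.
Proof.
move=> /andP[q0 q1] e0.
have /cvg_expr : `|q| < 1 by rewrite ger0_norm.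
move=> /cvgrPdist_lt /(_ _ e0)[k _ kP]; exists k.
by have := kP k (leqnn k); rewrite /= sub0r normrN ger0_norm// exprn_ge0.
Qed.

Lemma powRX {R : realType} (x s : R) k : 0 <= x -> (x ^+ k) `^ s = (x `^ s) ^+ k.
Proof.
move=> x0; elim: k => [|k IH]; first by rewrite !expr0 powR1.
by rewrite !exprS powRM ?exprn_ge0// IH.
Qed.

(** For [D > 0] take [k] with [2^-(k+1) < D <= 2^-k]; rounding costs a factor 2 to the power [s'].
    The term [eta] pays for [D = 0], where no such [k] exists. *)
Lemma dyadic_radius {R : realType} (D s s' eta : R) :
  0 <= D <= 1 -> 0 <= s < s' -> 0 < eta ->
  exists k, D <= 2^-1 ^+ k /\ (2 `^ (- s')) ^+ k <= 2 `^ s' * D `^ s + eta.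
Proof.
move=> /andP[D0 D1] /andP[s0 ss'] eta0.
have rhs0 : 0 <= 2 `^ s' * D `^ s by rewrite mulr_ge0// powR_ge0.
have q01 : 0 <= 2 `^ (- s') < 1.
  rewrite powR_ge0/= powRN invf_lt1 ?powR_gt0//.
  have := @gt0_ltr_powR R s'; rewrite (le_lt_trans s0 ss') => /(_ isT 1 2).
  by rewrite powR1; apply; rewrite ?nnegrE ?ltr1n.
have [D00|Dn0] := eqVneq D 0.
  have [k kP] := expr_lt_small _ _ q01 eta0; exists k; split.
    by rewrite D00 exprn_ge0.
  by rewrite -[leLHS]add0r lerD// ltW.
have Dgt : 0 < D by rewrite lt0r Dn0.
have ex : exists k, 2^-1 ^+ k < D.
  by apply: expr_lt_small => //; apply/andP; split; lra.
case: (ex_minnP ex) => -[|k] kD kmin; first by move: kD; rewrite expr0 ltNge D1.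
have Dk : D <= 2^-1 ^+ k.
  by rewrite leNgt; apply/negP => /kmin; rewrite ltnn.
exists k; split => //.
have -> : (2 `^ (- s')) ^+ k = 2 `^ s' * (2^-1 ^+ k.+1) `^ s'.
  rewrite powRX ?invr_ge0// exprS mulrA -powRM ?invr_ge0// divff ?pnatr_eq0//.
  rewrite powR1 mul1r; congr (_ ^+ k).
  have h : 2 `^ s' != 0 :> R by rewrite gt_eqF// powR_gt0.
  by apply: (mulfI h); rewrite powRN divff// -powRM ?invr_ge0// divff ?pnatr_eq0// powR1.
apply: (@le_trans _ _ (2 `^ s' * D `^ s)); last by rewrite lerDl ltW.
rewrite ler_wpM2l ?powR_ge0//; apply: (@le_trans _ _ (D `^ s')).
  by apply: ge0_ler_powR; rewrite ?nnegrE ?exprn_ge0//; lra.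
by apply: ger_powR; [rewrite Dgt|exact: ltW].
Qed.

(** * Points of the tilted meridians *)

(** The hyperplane is the image of the injective map [phi], which repeats entry 0 of [y], times [t],
    as coordinate 1. It contains the poles because [d >= 3] puts their nonzero coordinate at index 2
    or later. *)
Lemma tilted_meridian {R : realType} (n d : nat) (i0 i1 : 'I_n) (t : R) :
  (3 <= d <= n)%N -> i0 = 0%N :> nat -> i1 = 1%N :> nat ->
  exists2 C : set 'rV[R]_n, meridian d C &
    forall x, sphere d x -> x 0 i1 = t * x 0 i0 -> C x.
Proof.
case: n i0 i1 => [[]//|n] i0 i1; case: d => [|[|[|d]]]// dn i00 i11.
pose phi (y : 'rV[R]_d.+2) : 'rV[R]_n.+1 := \row_j
  (if (j < d.+3)%N then (if j == 1%N :> nat then t else 1) * y 0 (inord j.-1) else 0).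
have philin : linear phi.
  move=> a u v; apply/rowP => j; rewrite !mxE.
  by case: ifP => _; [case: ifP => _; ring|ring].
pose phiL : {linear 'rV[R]_d.+2 -> 'rV[R]_n.+1} :=
  HB.pack phi (GRing.isLinear.Build _ _ _ _ phi philin).
pose V := limg (linfun phiL).
have dimV : \dim V = d.+2.
  rewrite limg_dim_eq ?dimvf /dim/= ?mul1n//.
  apply/eqP; rewrite capfv; apply/lker0P => u v; rewrite !(lfunE phiL) /= => e.
  apply/rowP => i; case: (ltnP 0 i) => i0'.
    have /rowP/(_ (inord i.+1)) := e; rewrite !mxE inordK; last by have := ltn_ord i; lia.
    rewrite ltnS ltn_ord /= (_ : i.+1 == 1%N = false); last by lia.
    by rewrite !mul1r inord_val.
  have /rowP/(_ ord0) := e; rewrite !mxE /= !mul1r.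
  by rewrite (_ : inord 0 = i)//; apply: val_inj; rewrite /= inordK//; lia.
have inV x : coord_subspace d.+3 x -> x 0 i1 = t * x 0 i0 -> x \in V.
  move=> x0 x1.
  pose y : 'rV[R]_d.+2 := \row_i x 0 (inord (if i == 0%N :> nat then 0%N else i.+1)).
  suff -> : x = linfun phiL y by exact: memv_img (memvf _).
  rewrite (lfunE phiL) /=; apply/rowP => j; rewrite !mxE.
  case: ltnP => [jd|dj]; last exact: x0.
  case: eqVneq => [j1|j1].
    rewrite j1 /= inordK//=; rewrite (_ : j = i1); last by apply: val_inj; rewrite /= j1 i11.
    by rewrite x1; congr (_ * x 0 _); apply: val_inj; rewrite /= inordK.
  rewrite mul1r inordK; last by lia.
  congr (x 0 _); apply: val_inj; rewrite /= inordK; first by case: eqVneq => ?; lia.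
  by have := ltn_ord j; case: eqVneq; lia.
pose H : set 'rV[R]_n.+1 := [set 0 + v | v in [set` V]].
have HV x : x \in V -> H x by move=> xV; exists x => //; rewrite add0r.
have NV : north_pole R n.+1 d.+3 \in V.
  apply: inV => [i id|]; rewrite !mxE; first by case: eqVneq => //; lia.
  by rewrite i00 i11 /= mulr0.
exists (sphere d.+3 `&` H).
  exists H; split => //.
  - by exists 0, V.
  - move=> x [v /= /memv_imgP[y _ ->] <-] j dj; rewrite add0r (lfunE phiL) /= mxE.
    by rewrite ltnNge dj.
  - exact: HV.
  - by apply: HV; rewrite rpredN.
by move=> x [xd x1] xt; split => //; apply/HV/inV.
Qed.

(** The pole coordinate solves the sphere equation: the other coordinates are at most [1 / n] in
    absolute value, so their squares sum to at most 1. *)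
Lemma tilted_sphere_point {R : realType} (n d : nat) (i0 i1 : 'I_n) (t : R)
    (v : 'I_n -> R) :
  (3 <= d <= n)%N -> i0 = 0%N :> nat -> i1 = 1%N :> nat -> 0 <= t <= 1 ->
  (forall j : 'I_n, (j < d.-1)%N -> j != i1 -> `|v j| <= n%:R^-1) ->
  exists x : 'rV[R]_n, [/\ sphere d x, x 0 i1 = t * x 0 i0 &
    forall j : 'I_n, (j < d.-1)%N -> j != i1 -> x 0 j = v j].
Proof.
move=> /andP[d3 dn] i00 i11 /andP[t0 t1] vb.
have dn1 : (d.-1 < n)%N by lia.
pose dd := Ordinal dn1.
pose u (j : 'I_n) := if j == i1 then t * v i0 else v j.
have i01 : i0 != i1 by apply/eqP => /(congr1 val) /=; rewrite i00 i11.
have ub (j : 'I_n) : (j < d.-1)%N -> `|u j| <= n%:R^-1.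
  rewrite /u; case: eqVneq => [->|ji] jd; last exact: vb.
  rewrite normrM (ger0_norm t0) -[leRHS]mul1r ler_pM//.
  by apply: vb => //; rewrite i00; lia.
have S1 : \sum_(j < n | (j < d.-1)%N) u j ^+ 2 <= 1.
  have n0 : 0 < n%:R :> R by rewrite ltr0n; lia.
  apply: (@le_trans _ _ (\sum_(j < n) n%:R^-1)); last first.
    by rewrite sumr_const card_ord -(mulr_natl (_^-1)) divff// gt_eqF.
  rewrite big_mkcond; apply: ler_sum => j _; case: ifPn => jd; last by rewrite invr_ge0 ltW.
  rewrite -real_normK ?num_real// expr2 -[leRHS]mulr1 ler_pM//; first exact: ub.
  by apply: (le_trans (ub _ jd)); rewrite invf_le1// ler1n; lia.
set S := \sum_(j < n | _) _ in S1.
pose x : 'rV[R]_n := \row_j (if (j < d.-1)%N then u j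
  else if j == dd then Num.sqrt (1 - S) else 0).
exists x; split; last 2 first.
- have d1 : (i1 < d.-1)%N by rewrite i11; lia.
  have d0 : (i0 < d.-1)%N by rewrite i00; lia.
  rewrite [LHS]mxE [in RHS]mxE d1 d0.
  by rewrite /u eqxx (negbTE i01).
- by move=> j jd ji; rewrite mxE jd /u (negbTE ji).
split.
- move=> j dj; rewrite mxE ifF; last by lia.
  by rewrite ifF//; apply/eqP => /(congr1 val) /=; lia.
- rewrite (bigD1 dd) /=; last by lia.
  rewrite mxE ltnn eqxx sqr_sqrtr ?subr_ge0//.
  rewrite (eq_bigl (fun j : 'I_n => (j < d.-1)%N)) => [|j]; last first.
    by rewrite -val_eqE /=; lia.
  rewrite (eq_bigr (fun j => u j ^+ 2)) => [|j jd]; last by rewrite mxE jd.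
  by rewrite -/S subrK.
Qed.

(** * Cubes of dyadic radius covering a null set *)

Lemma coord_le_enorm {R : realType} n (x : 'rV[R]_n) j : `|x 0 j| <= enorm x.
Proof.
rewrite -sqrtr_sqr ler_wsqrtr// (bigD1 j)//= lerDl sumr_ge0// => i _.
exact: sqr_ge0.
Qed.

(* Covering sets of diameter 0 are given a tiny positive radius. *)
Lemma hausdorff_null_cover {R : realType} (n : nat) (K : set 'rV[R]_n) (s s' eta : R) :
  0 <= s < s' -> 0 < eta -> hausdorff_measure s K = 0%E ->
  exists (A : pred nat) (P : nat -> 'rV[R]_n) (r : nat -> nat),
    (forall x, K x -> exists i, A i /\ forall j, `|x 0 j - P i 0 j| <= 2^-1 ^+ r i) /\
    (\sum_(0 <= i <oo | A i) ((2 `^ (- s')) ^+ r i)%:E <= eta%:E)%E.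
Proof.
move=> ss' eta0 HK.
have C0 : 0 < 2 `^ s' :> R by rewrite powR_gt0.
(* The main sum times 2 to the power [s'] and the errors [e / 2^(i+1)] then add up to at most
   [eta]. *)
pose e := eta / (2 `^ s' + 1).
have e0 : 0 < e by rewrite divr_gt0// ltr_wpDr.
have [_ [U [KU dU] <-] sumU] :
    exists2 y, [set (\sum_(0 <= i <oo) diam_pow s (U i))%E | U in delta_cover 1 K] y
      & (y < e%:E)%E.
  apply: ereal_inf_lt; apply: (@le_lt_trans _ _ (hausdorff_measure s K)).
    by apply: ereal_sup_ubound; exists 1 => //=.
  by rewrite HK lte_fin.
pose A i := U i != set0.
(* Any point of a nonempty [U i] serves as centre: the diameter is then a radius in every
   coordinate. *)
have /choice[P PU] i : exists x, A i -> U i x.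
  by rewrite /A; case: (boolP (U i != set0)) => [/set0P[x Ux]|_]; [exists x|exists 0].
pose D i := fine (ediam (U i)).
have DE i : A i -> [/\ 0 <= D i <= 1, ediam (U i) = (D i)%:E &
    forall x y, U i x -> U i y -> enorm (x - y) <= D i].
  move=> Ai.
  have ub x y : U i x -> U i y -> ((enorm (x - y))%:E <= ediam (U i))%E.
    by move=> Ux Uy; apply: ereal_sup_ubound; exists x => //; exists y.
  have ge0 : (0 <= ediam (U i))%E.
    by apply: le_trans (ub _ _ (PU i Ai) (PU i Ai)); rewrite lee_fin sqrtr_ge0.
  have fin : ediam (U i) \is a fin_num.
    by rewrite ge0_fin_numE//; apply: le_lt_trans (dU i) _; rewrite ltry.
  split; last 2 first.
  - by rewrite fineK.
  - by move=> x y Ux Uy; rewrite -lee_fin fineK//; exact: ub.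
  by rewrite fine_ge0//= -lee_fin fineK.
have /choice[r rP] i : exists k, A i -> D i <= 2^-1 ^+ k /\
    (2 `^ (- s')) ^+ k <= 2 `^ s' * D i `^ s + e / (2 ^ i.+1)%:R.
  case: (boolP (A i)) => [Ai|_]; last by exists 0%N.
  have [D01 _ _] := DE i Ai.
  have ei0 : 0 < e / (2 ^ i.+1)%:R by rewrite divr_gt0// ltr0n expn_gt0.
  by have [k kP] := dyadic_radius _ _ _ _ D01 ss' ei0; exists k.
exists A, P, r; split.
  move=> x /KU[i _ Uix]; have Ai : A i by apply/set0P; exists x.
  exists i; split => // j; have [_ _ dist] := DE i Ai.
  apply: le_trans (rP i Ai).1; apply: le_trans (dist _ _ Uix (PU i Ai)).
  by have := coord_le_enorm _ (x - P i) j; rewrite !mxE.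
have dp0 i : (0 <= diam_pow s (U i))%E.
  by rewrite /diam_pow; case: ifP => _; rewrite ?poweR_ge0.
apply: (@le_trans _ _ (\sum_(0 <= i <oo)
    ((2 `^ s')%:E * diam_pow s (U i) + (e / (2 ^ i.+1)%:R)%:E))%E).
  rewrite eseries_mkcond; apply: lee_nneseries => [i _ _|i _].
    by case: ifP => _ //; rewrite lee_fin exprn_ge0// powR_ge0.
  case: ifPn => [Ai|_]; last first.
    by rewrite adde_ge0// ?mule_ge0// lee_fin ?ltW// divr_gt0.
  have [_ DiE _] := DE i Ai.
  rewrite /diam_pow (negbTE Ai) DiE poweR_EFin -EFinM -EFinD lee_fin.
  exact: (rP i Ai).2.
apply: le_trans (epsilon_trick _ _ (ltW e0)) _ => [i|].
  by rewrite mule_ge0// lee_fin ltW.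
rewrite nneseriesZl//.
apply: (@le_trans _ _ ((2 `^ s')%:E * e%:E + e%:E)%E).
  by apply/leeD2r/lee_wpmul2l; [rewrite lee_fin ltW|exact: ltW].
rewrite -EFinM -EFinD lee_fin -[X in _ + X]mul1r -mulrDl mulrC /e divfK//.
Qed.

(** * Reduction of the meridian problem to the plane *)

(** The slicing directions [2, ..., d - 2]: coordinates 0 and 1 span the plane of Kakeya's problem,
    and the pole coordinate [d - 1] is projected away. *)
Lemma middle_indices (n d : nat) (i0 i1 : 'I_n) :
  (3 <= d <= n)%N -> i0 = 0%N :> nat -> i1 = 1%N :> nat ->
  exists L : seq 'I_n, [/\ uniq L, size L = (d - 3)%N &
    forall j, (j \in L) = [&& (j < d.-1)%N, j != i1 & j != i0]].
Proof.
move=> hd i00 i11; exists [seq insubd i0 j | j <- iota 2 (d - 3)].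
have val_i m : m \in iota 2 (d - 3) -> insubd i0 m = m :> nat.
  by rewrite mem_iota val_insubd => m2; rewrite ifT//; lia.
split; last 2 first.
- by rewrite size_map size_iota.
- move=> j; apply/mapP/idP => [[m mi ->]|].
    by rewrite -!val_eqE /= val_i// i00 i11; move: mi; rewrite mem_iota; lia.
  rewrite -!val_eqE /= i00 i11 => hj.
  have ji : val j \in iota 2 (d - 3) by rewrite mem_iota /=; lia.
  by exists (val j) => //; apply: val_inj; rewrite /= val_i.
- rewrite map_inj_in_uniq ?iota_uniq// => m m' mi mi'.
  by move=> /(congr1 val); rewrite /= !val_i.
Qed.

Theorem theorem6 (R : realType) (n d : nat) (K : set 'rV[R]_n)
    (hn : (4 <= n)%N) (hd3 : (3 <= d)%N) (hdn : (d <= n)%N)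
    (hKbounded : bounded_set K)
    (hK : forall C : set 'rV[R]_n, meridian d C ->
       exists (a : 'rV[R]_n) (r : R),
         0 < r /\ [set a + r *: x | x in C] `<=` K) :
  ((d%:R - 1)%:E <= hausdorff_dim K)%E.
Proof.
have n0 : (0 : R) < n%:R by rewrite ltr0n; lia.
have n0' : (0 < n)%N by lia. have n1' : (1 < n)%N by lia.
pose i0 := Ordinal n0'; pose i1 := Ordinal n1'.
have i01 : i0 != i1 by [].
have d0 : (0 < d)%N by lia.
have d0' : (0 < d.-1)%N by lia.
have d13 : (d - 1 = d - 3 + 2)%N by lia.
have hd : (3 <= d <= n)%N by rewrite hd3.
apply: le_ereal_inf_tmp => _ [s [s0 HK] <-]; rewrite lee_fin leNgt; apply/negP => sd.
(* The midpoint leaves room on both sides: [s < s'] for rounding to dyadic radii, [s' < d - 1] for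
   [y > 1]. *)
pose s' := (s + (d%:R - 1)) / 2.
have ss' : 0 <= s < s' by rewrite s0 /s'; lra.
have s'd : s' < d%:R - 1 by rewrite /s'; lra.
(* Over a cube of half side [r / n] about its centre [a], the copy of the meridian of slope [t]
   projects onto a graph whose intercept depends on [t] alone. The pair [(0, 0)] is a default for
   [t] outside [[0, 1]]. *)
have /choice[ar arP] t : exists ar : 'rV[R]_n * R, 0 <= t <= 1 -> 0 < ar.2 /\
    forall w : 'I_n -> R,
      (forall j : 'I_n, (j < d.-1)%N -> j != i1 -> `|w j - ar.1 0 j| <= ar.2 / n%:R) ->
      exists p, [/\ K p, p 0 i1 = t * w i0 + (ar.1 0 i1 - t * ar.1 0 i0) &
        forall j : 'I_n, (j < d.-1)%N -> j != i1 -> p 0 j = w j].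
  case: (boolP (0 <= t <= 1)) => [t01|_]; last by exists (0, 0).
  have [C mC CP] := tilted_meridian n d i0 i1 t hd erefl erefl.
  have [a [r [r0 aK]]] := hK C mC; exists (a, r) => _; split => // w wP.
  have [j jd ji|x [Sx x1 xj]] := tilted_sphere_point n d i0 i1 t
      (fun j => (w j - a 0 j) / r) hd erefl erefl t01.
    rewrite normrM normfV (gtr0_norm r0) ler_pdivrMr// mulrC; exact: wP.
  exists (a + r *: x); split.
  - by apply: aK; exists x => //; exact: CP.
  - rewrite !mxE x1 xj//.
    by field; rewrite gt_eqF.
  - by move=> j jd ji; rewrite !mxE xj//; field; rewrite gt_eqF.
pose a t := (ar t).1; pose r t := (ar t).2.
have /choice[h hP] t : exists h : nat, 0 <= t <= 1 -> 2^-1 ^+ h < r t / n%:R.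
  case: (boolP (0 <= t <= 1)) => [t01|_]; last by exists 0%N.
  have [r0 _] := arP t t01.
  have [||k kP] := @expr_lt_small R 2^-1 (r t / n%:R); last by exists k.
  - by apply/andP; split; lra.
  - by rewrite divr_gt0.
(* There are countably many codes. Slopes in [[0, 1]] with equal codes have centres whose
   coordinates share cells of one side, smaller than [r t / n]; that common box lies in the domain
   of all their graphs. *)
pose code t := (h t, [ffun j : 'I_n => Num.floor (2 ^+ h t * a t 0 j)]).
have [k [e [e0 eT]]] := outer_lebesgue_pigeonhole (fun t : R => pickle (code t)).
set T := [set t | _] in eT.
have [t0 Tt0] : T !=set0.
  apply/set0P/eqP => T0; move: eT; rewrite T0 mu_ext0//; first by rewrite lee_fin leNgt e0.
pose l : R := 2^-1 ^+ h t0.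
pose lo (j : 'I_n) : R := (Num.floor (2 ^+ h t0 * a t0 0 j))%:~R * l.
have l0 : 0 < l by rewrite exprn_gt0// invr_gt0.
have l1 : l <= 1 by rewrite exprn_ile1//; lra.
have loP t j x : T t -> lo j <= x <= lo j + l -> `|x - a t 0 j| <= r t / n%:R.
  move=> [t01 tk] xlo; have hl := hP t t01.
  have [_ t0k] := Tt0.
  have /(pcan_inj (@pickleK _)) : pickle (code t) = pickle (code t0) by rewrite tk t0k.
  move=> [ht /ffunP/(_ j)]; rewrite !ffunE ht => fl.
  apply: le_trans (ltW hl); rewrite ht -/l.
  have := floor_itv (2 ^+ h t0 * a t 0 j); rewrite fl => /andP[f1 f2].
  have ll : l * 2 ^+ h t0 = 1 by rewrite -exprMn mulVf ?expr1n.
  move: f1 f2 xlo; rewrite /lo; set z := Num.floor _; rewrite intrD => f1 f2 /andP[x1 x2].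
  have {}f1 : z%:~R * l <= (2 ^+ h t0 * a t 0 j) * l by rewrite ler_pM2r.
  have {}f2 : (2 ^+ h t0 * a t 0 j) * l < (z%:~R + 1) * l by rewrite ltr_pM2r.
  have E : (2 ^+ h t0 * a t 0 j) * l = a t 0 j by rewrite mulrC mulrA ll mul1r.
  rewrite E in f1 f2; rewrite ler_distl; apply/andP; split; lra.
pose b t := a t 0 i1 - t * a t 0 i0.
(* Makes [y ^+ 5] equal to 2 to the power [d - 1 - s']: the planar weight is then the radius to the
   power [s' - (d - 3)], and [d - 3] slicings raise the exponent to [s']. *)
pose y : R := 2 `^ ((d%:R - 1 - s') / 5).
have y1 : 1 < y.
  have lt12 : 1 < 2 :> R by rewrite ltr1n.
  have p0 : 0 < (d%:R - 1 - s') / 5 by lra.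
  by rewrite -(powRr0 2) /y /powR pnatr_eq0 /= ltr_expR ltr_pM2r// ln_gt0.
have T01 : T `<=` `[0, 1]%classic by move=> t [t01 _]; rewrite /= in_itv.
have [|c c0 cP] := kakeya_plane T b e (lo i0) (lo i0 + l) y T01 e0 eT _ y1.
  by apply/andP; split; lra.
have [L [uL sL LE]] := middle_indices n d i0 i1 hd erefl erefl.
(* With the factor [2 ^+ (d - 3)] coming from the interval widths [2 * d i], this cover sums to at
   most half of the lower bound [c * l ^+ (d - 3)]. *)
pose c' := c * l ^+ (d - 3) / 2 ^+ (d - 3) / 2.
have c'0 : 0 < c' by rewrite !divr_gt0// ?mulr_gt0// exprn_gt0.
have [A [P [ri [KA sumA]]]] := hausdorff_null_cover _ _ _ _ _ ss' c'0 HK.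
have cyl := cylinder_content n (R * R)%type
  (fun u => T u.1 /\ lo i0 <= u.2 <= lo i0 + l)
  (fun u i => `|u.2 - P i 0 i0| <= 2^-1 ^+ ri i /\
              `|u.1 * u.2 + b u.1 - P i 0 i1| <= 2^-1 ^+ ri i)
  (fun i => (y ^+ 5 / 4) ^+ ri i) (fun i => 2^-1 ^+ ri i) (fun i j => P i 0 j)
  lo l c L (ltW l0) uL.
have y50 : 0 <= y ^+ 5 / 4 by rewrite divr_ge0// exprn_ge0// powR_ge0.
have := cyl (fun i => exprn_ge0 _ y50) _ _ A _; rewrite sL => {}cyl.
have : ((c * l ^+ (d - 3))%:E <=
    \sum_(0 <= i <oo | A i) ((y ^+ 5 / 4) ^+ ri i * (2 * 2^-1 ^+ ri i) ^+ (d - 3))%:E)%E.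
  apply: cyl => [i|A' cov|[t x] w /= [Tt xlo] wL].
  - by rewrite exprn_ge0.
  - apply: (cP A' (fun i => P i 0 i0) (fun i => P i 0 i1) ri) => t x Tt xlo.
    by have [|i [Ai [h1 h2]]] := cov (t, x); [split|exists i].
  have [t01 _] := Tt; have [_ inK] := arP t t01.
  (* The abscissa [x] of the planar problem fills coordinate [i0]; [w] supplies the sliced ones. *)
  have [j jd j1|p [Kp p1 pj]] := inK (fun j => if j == i0 then x else w j).
    case: eqVneq => [->|j0]; first exact: (loP t i0 x Tt).
    by apply: (loP t j _ Tt); by apply: wL; rewrite LE jd j1 j0.
  have [i [Ai iP]] := KA p Kp; exists i; split => //.
    split.
      by have := iP i0; rewrite pj// eqxx.
    by have := iP i1; rewrite p1 eqxx.
  move=> j; rewrite LE => /and3P[jd j1 j0]; have := iP j.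
  by rewrite pj// (negbTE j0).
have yE : y ^+ 5 / 4 * 2^-1 ^+ (d - 3) = 2 `^ (- s').
  have -> : y ^+ 5 = 2 `^ (d%:R - 1 - s').
    by rewrite -powR_mulrn ?powR_ge0// -powRrM; congr (_ `^ _); field.
  have -> : d%:R - 1 - s' = (d - 1)%:R + - s' by rewrite natrB.
  rewrite powRD ?pnatr_eq0 ?implybT// powR_mulrn//.
  rewrite d13.
  rewrite exprD exprVn; field.
  by rewrite expf_neq0.
have termE i : (y ^+ 5 / 4) ^+ ri i * (2 * 2^-1 ^+ ri i) ^+ (d - 3) =
    2 ^+ (d - 3) * (2 `^ (- s')) ^+ ri i.
  by rewrite -yE !exprMn -!exprM [(ri i * _)%N]mulnC; ring.
under eq_eseriesr do rewrite termE EFinM.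
rewrite nneseriesZl; last by move=> i _; rewrite lee_fin exprn_ge0// powR_ge0.
have p20 : (0 : R) < 2 ^+ (d - 3) by rewrite exprn_gt0.
move=> /le_trans/(_ (lee_wpmul2l _ sumA)); rewrite !lee_fin ltW// => /(_ isT).
have -> : 2 ^+ (d - 3) * c' = c * l ^+ (d - 3) / 2.
  by rewrite /c'; field; rewrite gt_eqF.
have : 0 < c * l ^+ (d - 3) by rewrite mulr_gt0// exprn_gt0.
lra.
Qed.
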